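(* Let $C \ge 1$ be a constant. Then for every sufficiently large integer $k$ (that is, for all integers $k \ge k_0$ for some $k_0$ depending only on $C$) there exist integers $x, y$ with $0<x<y$ and $y>x+k$ such that $$\operatorname{lcm}\{x,x+1,\ldots,x+k-1\} > C \cdot\operatorname{lcm}\{y,y+1,\ldots,y+k\}.$$
   Context: $\operatorname{lcm}$ of a finite set of positive integers is the smallest positive integer divisible by each number in the set. The left-hand set consists of $k$ consecutive integers, the right-hand set of $k+1$ consecutive integers. *)

(* Defs.v *)
From mathcomp Require Import all_boot all_order all_algebra.
From mathcomp Require Import reals.

Set Implicit Arguments.
Unset Strict Implicit.
Unset Printing Implicit Defensive.

(* Main.v *)
Require Import Defs.
From mathcomp Require Import all_boot all_order all_algebra.
From mathcomp Require Import reals.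
From mathcomp Require Import zify.

Set Implicit Arguments.
Unset Strict Implicit.
Unset Printing Implicit Defensive.

(** Write L for lcm(1, ..., k), and compare the windows x, ..., x+k-1 and
    y, ..., y+k through their products. The product of a window exceeds its lcm
    because a prime power q <= k usually divides several of its members; only the
    number of multiples of q matters, and it takes one of two consecutive values
    as the window moves. Suppose that, for every prime power q <= k, the x-window
    has as few multiples of q as possible and the y-window as many as possible,
    that is, one more. Then lcm_mul_dvd_of_gain gives
      lcm(y-window) * L * prod(x-window) <= lcm(x-window) * prod(y-window).
    If moreover D = y - x is small compared with x / k, the product of the y-window
    is at most about 8 * x times that of the x-window (prod_shift_le), so the
    quotient of the two lcms is at least L / (8 * x). It remains to satisfy all
    these residue conditions with x at most a small constant times L
    (gain_everywhere); L itself is a period of the conditions.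

    The choice x = y = -k modulo every q is admissible but leaves no freedom. For
    a prime p with p ^ 2 > k, however, only q = p matters, and x and y are
    admissible as soon as p divides x + k + i and y + k - i' with
    i + (k mod p) < p and i' <= k mod p. So if D = J mod p, with J at most the
    distance from k to the nearest multiples of p, then i may be any integer from
    0 to J. Changing i by g moves x by a multiple of L / p; by Dirichlet's box
    principle (small_multiple) some change with |g| < N moves x by a distance
    between L / p and 2 * L / N. Such a move can be repeated about J / N times, and
    with sufficiently many such primes the moves add up to more than a whole period
    while each is at most 2 * L / N, so x can be brought down to the order of L / N
    (descend_sum).

    The number of primes required is a large multiple of the square root of k.
    This follows from the bound 2 ^ k <= (k + 1) * k ^ pi(k), given by the prime
    factorization of binomial coefficients, and from the fact that few large
    primes divide a number close to k (nprimes_gap). *)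

Local Open Scope nat_scope.

(** * Prime powers in windows of consecutive integers *)

Definition lcm_itv a b := \big[lcmn/1]_(a <= n < b) n.

Lemma pfactor_dvd_lcmn p j m n : prime p -> 0 < m -> 0 < n ->
  (p ^ j %| lcmn m n) = (p ^ j %| m) || (p ^ j %| n).
Proof.
move=> pp m0 n0; rewrite !pfactor_dvdn ?lcmn_gt0 ?m0 //.
by rewrite logn_lcm // leq_max.
Qed.

Lemma lcm_itv_gt0 a b : 0 < a -> 0 < lcm_itv a b.
Proof.
move=> a0; rewrite /lcm_itv big_seq_cond; elim/big_ind: _ => //.
  by move=> m n m0 n0; rewrite lcmn_gt0 m0.
by move=> i; rewrite mem_index_iota andbT => /andP[ai _]; apply: leq_trans ai.
Qed.

Lemma pfactor_dvd_lcm_itv p j a b : prime p -> 0 < j -> 0 < a ->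
  reflect (exists2 n, a <= n < b & p ^ j %| n) (p ^ j %| lcm_itv a b).
Proof.
move=> pp j0 a0; have [ab|ba] := leqP a b; last first.
  rewrite /lcm_itv big_geq ?(ltnW ba) // dvdn1 -(expn0 p) eqn_exp2l ?prime_gt1 //.
  rewrite eqn0Ngt j0; constructor=> -[n]; lia.
elim: b ab => [|b IH] ab; first by lia.
have [ab'|ba] := leqP a b; last first.
  have -> : a = b.+1 by lia.
  rewrite /lcm_itv big_geq // dvdn1 -(expn0 p) eqn_exp2l ?prime_gt1 //.
  by rewrite eqn0Ngt j0; constructor=> -[n]; lia.
rewrite /lcm_itv big_nat_recr //= pfactor_dvd_lcmn ?lcm_itv_gt0 //; last lia.
apply: (iffP orP).
  case=> [/(IH ab')[n n1 n2]|d]; [exists n|exists b] => //; lia.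
case=> n n1 n2; case: (eqVneq n b) => [<-|nb]; [by right|left].
by apply/(IH ab'); exists n => //; lia.
Qed.

(** Each multiple of [q] that is passed raises the quotient by one. *)
Lemma sum_dvdn_divn q x n : 0 < q ->
  \sum_(i < n) (q %| x + i.+1) + x %/ q = (x + n) %/ q.
Proof.
move=> q0; elim: n => [|n IH]; first by rewrite big_ord0 addn0.
by rewrite big_ord_recr /= addnAC IH addnC addnS divnS.
Qed.

(** The first multiple of [q] after the window comes so late ([i] beyond its
    end) that the window contains the least possible number of multiples. *)
Lemma count_multiples_few q x k i : 0 < x -> q %| x + k + i -> i + k %% q < q ->
  \sum_(l < k) (q %| x + l) = k %/ q.
Proof.
case: x => // x _ /dvdnP[m hm] hi; have q0 : 0 < q by lia.
have h := sum_dvdn_divn x k q0.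
have -> : \sum_(l < k) (q %| x.+1 + l) = \sum_(l < k) (q %| x + l.+1).
  by apply: eq_bigr => l _; rewrite addSnnS.
have ek := divn_eq k q.
move: (k %/ q) (k %% q) ek hi => f r ek hi.
have hm1 : f < m.
  by rewrite -(ltn_pmul2r q0); lia.
have [m' em] : exists m', m = m' + f.+1 by exists (m - f.+1); lia.
have e1 : (x + k) %/ q = m' + f.
  have -> : x + k = (m' + f) * q + (q - 1 - i) by move: hm; rewrite em; nia.
  rewrite divnMDl // divn_small; lia.
have e2 : x %/ q = m'.
  have -> : x = m' * q + (q - 1 - i - r) by move: hm; rewrite em; nia.
  rewrite divnMDl // divn_small; lia.
lia.
Qed.

(** The last multiple of [q] in the window comes so close to its end that one
    more multiple fits in than in a generic window. *)
Lemma count_multiples_many q y k i : 0 < y -> i <= k %% q -> 0 < q -> i <= y + k ->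
   q %| y + k - i ->
  \sum_(l < k.+1) (q %| y + l) = (k %/ q).+1.
Proof.
case: y => // y _ hi q0 iyk /dvdnP[m hm].
have h := sum_dvdn_divn y k.+1 q0.
have -> : \sum_(l < k.+1) (q %| y.+1 + l) = \sum_(l < k.+1) (q %| y + l.+1).
  by apply: eq_bigr => l _; rewrite addSnnS.
have ek := divn_eq k q.
have hr : k %% q < q by rewrite ltn_mod.
move: (k %/ q) (k %% q) ek hi hr => f r ek hi hr.
have hm1 : f < m.
  by rewrite -(ltn_pmul2r q0); lia.
have [m' em] : exists m', m = m' + f.+1 by exists (m - f.+1); lia.
have e1 : (y + k.+1) %/ q = m.
  have -> : y + k.+1 = m * q + i by lia.
  rewrite divnMDl // divn_small; lia.
have e2 : y %/ q = m'.
  have -> : y = m' * q + (q + i - 1 - r) by move: hm; rewrite em; nia.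
  rewrite divnMDl // divn_small; lia.
lia.
Qed.

(** The two offsets certify that, among the multiples of [q], the window of k
    integers at [x] has the minimal number and the window of k+1 integers at [y]
    the maximal number, which is one more. The two windows are tied to each other
    only through such residue conditions. *)
Definition gain_at k x y q :=
  exists i j, [/\ i + k %% q < q, j <= k %% q, q %| x + k + i, j <= y + k & q %| y + k - j].

Lemma count_multiples_short q x k : 0 < x -> k < q ->
  \sum_(l < k) (q %| x + l) = [exists l : 'I_k, q %| x + l].
Proof.
move=> x0 kq.
case: (boolP [exists l : 'I_k, q %| x + l]) => [/existsP[l hl]|/existsPn h]; last first.
  by rewrite big1 // => l _; rewrite (negbTE (h l)).
rewrite (bigD1 l) //= hl big1 ?addn0 // => l' ll'.
case: (boolP (q %| x + l')) => // hl'.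
have : l' = l :> nat.
  wlog le : l l' hl hl' ll' / l <= l'.
    move=> H; case: (leqP l l') => c; first exact: H.
    by symmetry; apply: H => //; rewrite 1?eq_sym // ltnW.
  have : q %| l' - l by rewrite -(subnDl x) dvdn_sub.
  have := ltn_ord l'; move=> h1 h2.
  have := dvdn_leq _ h2; lia.
by move=> e; move: ll'; rewrite -(inj_eq val_inj) /= e eqxx.
Qed.

Lemma logn_sum_dvd p n B : prime p -> 0 < n -> n <= B ->
  logn p n = \sum_(1 <= j < B.+1) (p ^ j %| n).
Proof.
move=> pp n0 nB; rewrite logn_count_dvd // [in RHS](big_cat_nat (n:=n)) //=; last by lia.
rewrite [X in _ + X]big1_seq ?addn0 // => j /=; rewrite mem_index_iota => hj.
case: (boolP (_ %| _)) => // /(dvdn_leq n0) h.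
have := ltn_expl j (prime_gt1 pp); lia.
Qed.

Lemma logn_prod_sum p k x : prime p -> 0 < x ->
  logn p (\prod_(l < k) (x + l)) = \sum_(l < k) logn p (x + l).
Proof.
move=> pp x0; elim: k => [|k IH]; first by rewrite !big_ord0 logn1.
rewrite !big_ord_recr /= lognM ?IH //; last lia.
by apply/prodn_gt0 => l; lia.
Qed.

Lemma dvdn_logn m n : 0 < n -> 0 < m -> (forall p, prime p -> logn p m <= logn p n) -> m %| n.
Proof.
move=> n0 m0 h; apply/dvdn_partP => // p; rewrite mem_primes => /and3P[pp _ _].
by rewrite p_part pfactor_dvdn //; exact: h.
Qed.

(** The left-hand window has fewer multiples of every prime power up to k, so
    less is lost in passing from its product to its lcm. Counting, for each prime
    [p], the powers [p ^ j] that divide the factors, the inequality of valuations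
    holds for each [j] separately: for [p ^ j <= k] the gain of one multiple pays
    for the factor [p] in [lcm_itv 1 k.+1]; for [p ^ j > k] no window of k integers
    has two multiples. *)
Lemma lcm_mul_dvd_of_gain k x y : 0 < x -> 0 < y ->
  (forall p j, prime p -> 0 < j -> p ^ j <= k -> gain_at k x y (p ^ j)) ->
  lcm_itv y (y + k.+1) * lcm_itv 1 k.+1 * \prod_(l < k) (x + l)
   %| lcm_itv x (x + k) * \prod_(l < k.+1) (y + l).
Proof.
move=> x0 y0 G.
have px : 0 < \prod_(l < k) (x + l) by apply/prodn_gt0 => l; lia.
have py : 0 < \prod_(l < k.+1) (y + l) by apply/prodn_gt0 => l; lia.
have [ly lx l1] : [/\ 0 < lcm_itv y (y + k.+1), 0 < lcm_itv x (x + k) & 0 < lcm_itv 1 k.+1].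
  by rewrite !lcm_itv_gt0.
apply: dvdn_logn; rewrite ?muln_gt0 ?ly ?lx ?l1 ?px ?py // => p pp.
rewrite !lognM ?muln_gt0 ?ly ?lx ?l1 ?px ?py //.
rewrite !logn_prod_sum //.
pose B := lcm_itv y (y + k.+1) + lcm_itv x (x + k) + lcm_itv 1 k.+1 + x + y + k.
rewrite (eq_bigr (fun l : 'I_k => \sum_(1 <= j < B.+1) (p ^ j %| x + l))); last first.
  by move=> l _; rewrite (@logn_sum_dvd _ _ B) // /B; have := ltn_ord l; lia.
rewrite [X in _ <= _ + X](eq_bigr (fun l : 'I_k.+1 => \sum_(1 <= j < B.+1) (p ^ j %| y + l))); last first.
  by move=> l _; rewrite (@logn_sum_dvd _ _ B) // /B; have := ltn_ord l; lia.
rewrite ![logn _ _](@logn_sum_dvd _ _ B) //; try by rewrite /B; lia.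
rewrite [X in _ + X <= _]exchange_big [X in _ <= _ + X]exchange_big -!big_split /=.
rewrite big_nat [leqRHS]big_nat; apply: leq_sum => j /andP[j0 _].
have q0 : 0 < p ^ j by rewrite expn_gt0 prime_gt0.
have [qk|kq] := leqP (p ^ j) k.
  have [i [i' [h1 h2 h3 h4 h5]]] := G p j pp j0 qk.
  rewrite (count_multiples_few x0 h3 h1) (count_multiples_many y0 h2 q0 h4 h5).
  have -> : p ^ j %| lcm_itv x (x + k).
    apply/pfactor_dvd_lcm_itv => //.
    have : 0 < \sum_(l < k) (p ^ j %| x + l) by rewrite (count_multiples_few x0 h3 h1) divn_gt0.
    rewrite lt0n sum_nat_eq0 negb_forall => /existsP[l].
    rewrite implyTb eqb0 negbK => hl; exists (x + l) => //; have := ltn_ord l; lia.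
  lia.
rewrite (count_multiples_short x0 kq).
have -> : p ^ j %| lcm_itv 1 k.+1 = false.
  apply/negP => /(pfactor_dvd_lcm_itv _ pp j0) [] // n hn hd.
  by have := dvdn_leq _ hd; lia.
have h1 : [exists l : 'I_k, p ^ j %| x + l] <= (p ^ j %| lcm_itv x (x + k)).
  case: existsP => // -[l hl]; rewrite lt0b; apply/pfactor_dvd_lcm_itv => //.
  by exists (x + l) => //; have := ltn_ord l; lia.
have h2 : (p ^ j %| lcm_itv y (y + k.+1)) <= \sum_(l < k.+1) (p ^ j %| y + l).
  case: (boolP (_ %| lcm_itv y _)) => // /(pfactor_dvd_lcm_itv _ pp j0) [] // n hn hd.
  have hl : n - y < k.+1 by lia.
  rewrite (bigD1 (Ordinal hl)) //= subnKC; last lia.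
  by rewrite hd.
by rewrite addn0 addnC leq_add.
Qed.

(** * Large primes none of whose multiples is close to k *)

Definition nprimes k := count prime (iota 0 k.+1).

Lemma prime_dvd_fact p n : prime p -> p %| n`! -> p <= n.
Proof.
move=> pp; elim: n => [|n IH]; first by rewrite fact0 Euclid_dvd1.
rewrite factS Euclid_dvdM // => /orP[/dvdn_leq|/IH]; first exact.
exact: leqW.
Qed.

(** Legendre's formula for the three factorials: each power of [p] contributes
    at most one carry, and powers above [n] contribute none. *)
Lemma logn_bin_le p n m : prime p -> m <= n -> 0 < n -> p ^ logn p 'C(n, m) <= n.
Proof.
move=> pp mn n0; have p1 := prime_gt1 pp.
suff : logn p 'C(n, m) <= trunc_log p n.
  by move=> h; apply: leq_trans (trunc_logP p1 n0); rewrite leq_exp2l.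
have e : logn p n`! = logn p 'C(n, m) + (logn p m`! + logn p (n - m)`!).
  by rewrite -(bin_fact mn) !lognM // ?muln_gt0 ?fact_gt0 ?bin_gt0.
have S r : r <= n -> logn p r`! = \sum_(1 <= j < n.+1) r %/ p ^ j.
  move=> rn; rewrite logn_fact // [RHS](big_cat_nat (n:=r.+1)) //=.
  rewrite [X in _ + X]big1_seq ?addn0 // => j; rewrite mem_index_iota => /= hj.
  by rewrite divn_small //; have := ltn_expl j p1; lia.
move: e; rewrite !S ?leq_subr // -big_split /=.
suff : \sum_(1 <= j < n.+1) n %/ p ^ j <= trunc_log p n + \sum_(1 <= j < n.+1) (m %/ p ^ j + (n - m) %/ p ^ j) by lia.
have -> : trunc_log p n = \sum_(1 <= j < n.+1) (j <= trunc_log p n).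
  rewrite (big_cat_nat (n:=(trunc_log p n).+1)) //=; last first.
    by rewrite ltnS; have := trunc_logP p1 n0; have := ltn_expl (trunc_log p n) p1; lia.
  rewrite [X in _ + X]big1_seq ?addn0; last by move=> j; rewrite mem_index_iota => /= hj; lia.
  rewrite big_nat (eq_bigr (fun=> 1)); last by move=> j hj; lia.
  by rewrite -big_nat sum_nat_const_nat; lia.
rewrite -big_split /=; apply: leq_sum => j _.
have q0 : 0 < p ^ j by rewrite expn_gt0 ltnW.
have [jt|tj] := leqP j (trunc_log p n); last first.
  rewrite divn_small //; apply: leq_trans (trunc_log_ltn n p1) _.
  by rewrite leq_exp2l.
rewrite -{1}(subnKC mn) divnD // addnC leq_add2r.
exact: leq_b1.
Qed.

Lemma bin_le_primes n m : m <= n -> 0 < n -> 'C(n, m) <= n ^ nprimes n.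
Proof.
move=> mn n0; have c0 : 0 < 'C(n, m) by rewrite bin_gt0.
rewrite [leqLHS](prod_prime_decomp c0) prime_decompE big_map /=.
apply: (@leq_trans (\prod_(p <- primes 'C(n, m)) n)).
  rewrite big_seq [leqRHS]big_seq; apply: leq_prod => p.
  by rewrite mem_primes => /andP[pp _]; apply: logn_bin_le.
rewrite big_const_seq count_predT iter_muln_1.
apply: leq_pexp2l => //; rewrite /nprimes -size_filter.
apply: uniq_leq_size (primes_uniq _) _ => p; rewrite mem_primes => /and3P[pp _ pd].
rewrite mem_filter pp mem_iota /= ltnS.
have : p %| n`! by rewrite -(bin_fact mn) dvdn_mulr.
exact: prime_dvd_fact.
Qed.

Lemma exp2_le_primes n : 0 < n -> 2 ^ n <= n.+1 * n ^ nprimes n.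
Proof.
move=> n0; rewrite (expnDn 1 1 n).
apply: (@leq_trans (\sum_(i < n.+1) n ^ nprimes n)).
  by apply: leq_sum => i _; rewrite !exp1n !muln1 bin_le_primes // -ltnS.
by rewrite sum_nat_const card_ord.
Qed.

Lemma nprimes_lower n l : 0 < n < 2 ^ l -> n <= l * (nprimes n).+1.
Proof.
case/andP=> n0 nl; rewrite -(@leq_exp2l 2) // (leq_trans (exp2_le_primes n0)) //.
rewrite mulnS expnD leq_mul // expnM.
by case: (nprimes n) => // m; rewrite leq_exp2r // ltnW.
Qed.

Lemma sqr_le_exp2 n : n * n <= 2 * 2 ^ n.
Proof.
elim: n => // n IH; have [n3|n3] := ltnP n 3; first by case: n n3 {IH} => [|[|[|]]].
by rewrite expnS; nia.
Qed.

(** The Chebyshev-type bound [nprimes k >= k / log k] beats every multiple of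
    the square root of [k]; [B] is a power of two of the order of that root. *)
Lemma many_primes c : exists k0, forall k, k0 <= k ->
  exists B, [/\ 0 < B, 2 * k <= B ^ 2 & c * B <= nprimes k].
Proof.
(* With t the binary logarithm of k and h half of t + 1, a failure would give
   2 ^ h <= 4 * c * (2 * h + 1) <= 12 * c * h, against h ^ 2 <= 2 * 2 ^ h and
   24 * c < h. *)
exists (2 ^ (2 * (24 * c).+1)) => k hk.
have k0 : 0 < k by apply: leq_trans hk; rewrite expn_gt0.
pose t := trunc_log 2 k; pose h := t.+1./2.
have th : 2 * (24 * c).+1 <= t by apply: trunc_log_max.
have t1 : 2 ^ t <= k by apply: trunc_logP.
have t2 : k < 2 ^ t.+1 by apply: trunc_log_ltn.
have hh : h.*2 <= t.+1 <= h.*2.+1 by rewrite /h; lia.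
exists (2 ^ h.+1); split; first by rewrite expn_gt0.
  apply: (@leq_trans (2 * 2 ^ t.+1)); first lia.
  by rewrite -expnS -expnM leq_exp2l //; lia.
rewrite leqNgt; apply/negP => hp.
have h1 : k <= t.+1 * (nprimes k).+1 by apply: nprimes_lower; rewrite k0.
have h2 : 2 ^ h.*2 <= 2 * 2 ^ t by rewrite -expnS leq_exp2l //; lia.
have h3 : 2 ^ h.*2 = 2 ^ h * 2 ^ h by rewrite -addnn expnD.
have h4 := sqr_le_exp2 h.
have h5 : 0 < 2 ^ h by rewrite expn_gt0.
have h6 : 24 * c < h by lia.
have h7 : k <= t.+1 * (c * (2 * 2 ^ h)).
  by rewrite -expnS (leq_trans h1) // leq_mul2l hp orbT.
have h8 : 2 ^ h * 2 ^ h <= (4 * (t.+1 * c)) * 2 ^ h by rewrite -h3; lia.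
move: h8; rewrite leq_pmul2r // => h8.
have : 4 * (t.+1 * c) <= 4 * (h.*2.+1 * c) by rewrite leq_mul2l leq_mul2r; lia.
by nia.
Qed.

(** The last two conditions leave room for [J] units on either side of
    [k %% p] among the residues mod [p]. Because of the bound on [p ^ 2], a positive
    integer up to [2 * k] has at most one such divisor. *)
Definition gap_primes k J :=
  [seq p <- iota 0 k.+1 | [&& prime p, 2 * k < p ^ 2, J <= k %% p & k %% p + J < p]].

Lemma large_prime_divisor_unique k m p q : 0 < m <= 2 * k -> prime p -> prime q ->
  2 * k < p ^ 2 -> 2 * k < q ^ 2 -> p %| m -> q %| m -> p = q.
Proof.
case/andP=> m0 mk pp pq hp hq dp dq; apply/eqP/negPn/negP => npq.
have : p * q %| m by rewrite Gauss_dvd ?dp // prime_coprime // dvdn_prime2.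
move/(dvdn_leq m0) => h; nia.
Qed.

(** A prime that violates a gap condition divides one of the [2 * J] integers
    nearest to [k], and each of these has at most one prime divisor above the
    square root of [2 * k]. So, except for the primes up to [B], at most [2 * J]
    primes are lost. *)
Lemma nprimes_gap k J B : 0 < k -> J <= k -> 2 * k <= B ^ 2 ->
  nprimes k <= size (gap_primes k J) + B + 2 * J.
Proof.
move=> k0 Jk kB.
pose f m := head 0 [seq p <- iota 0 k.+1 | [&& prime p, 2 * k < p ^ 2 & p %| m]].
have fP m p : prime p -> p <= k -> 2 * k < p ^ 2 -> p %| m -> 0 < m <= 2 * k -> f m = p.
  move=> pp pk hp dp hm.
  have : f m \in [seq p <- iota 0 k.+1 | [&& prime p, 2 * k < p ^ 2 & p %| m]].
    have : p \in [seq p <- iota 0 k.+1 | [&& prime p, 2 * k < p ^ 2 & p %| m]].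
      by rewrite mem_filter pp hp dp mem_iota.
    by rewrite /f; case: [seq _ <- _ | _] => // a s _; rewrite mem_head.
  rewrite mem_filter => /andP[/and3P[h1 h2 h3] _].
  exact: large_prime_divisor_unique hm h1 pp h2 hp h3 dp.
rewrite /nprimes -size_filter.
pose s := gap_primes k J ++ iota 1 B ++ map f (iota (k - J).+1 (2 * J)).
have -> : size (gap_primes k J) + B + 2 * J = size s.
  by rewrite !size_cat size_map !size_iota addnA.
apply: uniq_leq_size; first by rewrite filter_uniq // iota_uniq.
move=> p; rewrite mem_filter mem_iota /= add0n ltnS => /andP[pp pk].
have p0 := prime_gt0 pp.
rewrite !mem_cat [p \in gap_primes _ _]mem_filter !mem_iota /= add0n ltnS pp pk andbT.
have [hp|hp] /= := ltnP; last first.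
  by rewrite p0 /= (_ : p < 1 + B) //; nia.
case: (boolP (_ && _)) => //= nh; rewrite (_ : (p \in _) = true) ?orbT //.
have ek := divn_eq k p; have rp : k %% p < p by rewrite ltn_mod.
have rk := leq_mod k p.
have [r1|r1] := ltnP (k %% p) J; apply/mapP.
  exists (k - k %% p); first by rewrite mem_iota; lia.
  by symmetry; apply: fP => //; [rewrite {1}ek addnK dvdn_mull | lia].
have r2 : p <= k %% p + J by move: nh; rewrite r1 /= -leqNgt.
exists (k + (p - k %% p)); first by rewrite mem_iota; lia.
symmetry; apply: fP => //; last by lia.
rewrite {1}ek -addnA subnKC; last exact: ltnW.
by rewrite dvdn_add // dvdn_mull.
Qed.

(** * Diophantine and elementary tools *)

(** Dirichlet's box argument: among the [p %/ N + 2] multiples [u * i], two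
    residues fall into the same box of length [N]. The sign of the small residue
    depends on which of the two is the larger. *)
Lemma small_multiple p u N : 0 < N <= p ->
  exists t g, [/\ 0 < t, t * N <= p + N, g < N & (p %| u * t + g) || ((g <= u * t) && (p %| u * t - g))].
Proof.
case/andP=> N0 Np; have p0 : 0 < p by apply: leq_trans Np.
pose b := (p %/ N).+1.
have bound m : (u * m) %% p %/ N < b.
  by rewrite ltnS leq_div2r // ltnW // ltn_mod.
pose f (i : 'I_b.+1) : 'I_b := Ordinal (bound i).
have : ~~ injectiveb f.
  apply/negP => /injectiveP /leq_card; rewrite !card_ord; lia.
case/injectivePn => i [j ij fij].
wlog lt : i j ij fij / i < j.
  move=> H; case: (ltngtP i j) => [c|c|/val_inj c].
  - exact: H c.
  - by apply: (H j i); rewrite 1?eq_sym.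
  - by rewrite c eqxx in ij.
have e : (u * i) %% p %/ N = (u * j) %% p %/ N by move: (congr1 val fij).
have jb := ltn_ord j.
have bt : b * N <= p + N by rewrite /b mulSn addnC leq_add2r leq_trunc_div.
have ea := divn_eq (u * i) p; have ec := divn_eq (u * j) p.
have le : u * i %/ p <= u * j %/ p by rewrite leq_div2r // leq_mul2l (ltnW lt) orbT.
have uij : u * (j - i) = u * j - u * i by rewrite mulnBr.
have uij' : u * i <= u * j by rewrite leq_mul2l (ltnW lt) orbT.
have ra : (u * i) %% p %% N < N by rewrite ltn_mod.
have rc : (u * j) %% p %% N < N by rewrite ltn_mod.
have da := divn_eq ((u * i) %% p) N; have dc := divn_eq ((u * j) %% p) N.
rewrite -e in dc.
have lp : u * i %/ p * p <= u * j %/ p * p by rewrite leq_mul2r le orbT.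
have jit : (j - i) * N <= p + N by apply: leq_trans bt; rewrite leq_mul2r; apply/orP; right; clear -jb; lia.
have ji0 : 0 < j - i by rewrite subn_gt0.
exists (j - i); move: ((u * i) %% p) ((u * j) %% p) ea ec da dc ra rc {e fij} => a c.
move: (a %/ N) (a %% N) (c %% N) (u * i %/ p) (u * j %/ p) le lp => w a' c' qi qj le lp ea ec da dc ra rc.
have em : (qj - qi) * p = qj * p - qi * p by rewrite mulnBl.
have [ac|ca] := leqP c a.
  exists (a - c); split=> //; first by clear - da dc ra; lia.
  apply/orP; left; rewrite (_ : _ + _ = (qj - qi) * p) ?dvdn_mull //.
  by rewrite em uij; clear -ea ec ac lp uij'; lia.
exists (c - a); split=> //; first by clear - da dc rc; lia.
apply/orP; right; apply/andP; split; first by clear -uij ea ec ca lp uij'; lia.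
rewrite (_ : _ - _ = (qj - qi) * p) ?dvdn_mull //.
by rewrite em uij; clear -ea ec ca lp uij'; lia.
Qed.

Lemma descend_one (V W x e B : nat) : V <= x -> e <= W -> x <= V + W + B * e ->
  exists2 n, n <= B & V + n * e <= x <= V + W + n * e.
Proof.
move=> Vx eW; elim: B => [|B IH] h; first by exists 0; lia.
have [hx|hx] := leqP x (V + W + B * e).
  by have [n h1 h2] := IH hx; exists n => //; lia.
by exists B.+1; lia.
Qed.

(** The primes are used one after another: either the [B] steps of the first
    prime do not fall below the target, and all of them are taken, or they end in
    it. No step is longer than [W], so the target of length [W] cannot be jumped
    over. *)
Lemma descend_sum (s : seq nat) (eps : nat -> nat) (V W x B : nat) : uniq s ->
  V <= x -> {in s, forall p, eps p <= W} -> x <= V + W + \sum_(p <- s) B * eps p ->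
  exists n : nat -> nat, (forall p, n p <= B) /\
    V + \sum_(p <- s) n p * eps p <= x <= V + W + \sum_(p <- s) n p * eps p.
Proof.
elim: s x => [|p s IH] x /=.
  by move=> _ h1 _; rewrite !big_nil => h; exists (fun=> 0); split=> //; rewrite !big_nil; lia.
case/andP=> ps us Vx hW; rewrite big_cons => hx.
have hW' : {in s, forall p, eps p <= W} by move=> q qs; apply: hW; rewrite inE qs orbT.
have ext n m : \sum_(q <- s) (if q == p then m else n q) * eps q = \sum_(q <- s) n q * eps q.
  apply: eq_big_seq => q qs; case: eqP => // e; by rewrite -e qs in ps.
have [c|c] := leqP (V + B * eps p) x.
  have [||n [n1 n2]] := IH (x - B * eps p) us _ hW'; [lia|lia|].
  exists (fun q => if q == p then B else n q); split.
    by move=> q; case: eqP.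
  by rewrite big_cons eqxx ext; lia.
have [//||m m1 m2] := @descend_one V W x (eps p) B Vx; [exact/hW/mem_head|lia|].
exists (fun q => if q == p then m else 0); split.
  by move=> q; case: eqP.
rewrite big_cons eqxx (ext (fun=> 0) m) (eq_bigr (fun=> 0)) // big1 // addn0; lia.
Qed.

Lemma chinese_seq (s : seq nat) M c (f : nat -> nat) : uniq s -> 0 < M ->
  {in s, forall p, prime p} -> {in s, forall p, coprime M p} ->
  exists x, (x = c %[mod M]) /\ {in s, forall p, x = f p %[mod p]}.
Proof.
elim: s M c => [|p s IH] M c /=; first by exists c.
case/andP=> ps us M0 hp hc.
have pp : prime p by apply/hp/mem_head.
have cMp : coprime M p by apply/hc/mem_head.
have [|||x [x1 x2]] := IH (M * p) (chinese M p c (f p)) us.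
- by rewrite muln_gt0 M0 prime_gt0.
- by move=> q qs; apply: hp; rewrite inE qs orbT.
- move=> q qs; rewrite coprimeMl hc ?inE ?qs ?orbT //=.
  rewrite prime_coprime // dvdn_prime2 //; last by apply: hp; rewrite inE qs orbT.
  by apply/eqP => e; rewrite e qs in ps.
have hd d : d %| M * p -> x = chinese M p c (f p) %[mod d].
  by move=> h; rewrite -(modn_dvdm x h) x1 modn_dvdm.
exists x; split; first by rewrite hd ?dvdn_mulr // chinese_modl.
move=> q; rewrite inE => /orP[/eqP->|]; last exact: x2.
by rewrite hd ?dvdn_mull // chinese_modr.
Qed.

(** A form of Bernoulli's inequality for the product of the window. *)
Lemma prod_shift_le k D y : k * D <= y ->
  (y - k * D) * \prod_(l < k) (y + l) <= y * \prod_(l < k) (y - D + l).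
Proof.
elim: k => [|k IH] h; first by rewrite !big_ord0; lia.
have h' : k * D <= y by lia.
have {}IH := IH h'; rewrite !big_ord_recr /=.
have D1 : D <= y by lia.
have [z ez] : exists z, y = z + k.+1 * D by exists (y - k.+1 * D); lia.
have k1 : (y - k.+1 * D) * (y + k) <= (y - k * D) * (y - D + k).
  rewrite ez mulSn; rewrite mulSn in ez.
  have -> : z + (D + k * D) - (D + k * D) = z by lia.
  have -> : z + (D + k * D) - k * D = z + D by lia.
  have -> : z + (D + k * D) - D = z + k * D by lia.
  nia.
rewrite !mulnA.
apply: (@leq_trans ((y - k * D) * \prod_(i < k) (y + i) * (y - D + k))).
  rewrite mulnAC [leqRHS]mulnAC; exact: leq_mul.
by rewrite leq_mul2r IH orbT.
Qed.

Lemma prod_sqr_ge (s : seq nat) a : {in s, forall p, a <= p ^ 2} -> a ^ size s <= (\prod_(p <- s) p) ^ 2.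
Proof.
elim: s => [|p s IH] h; first by rewrite big_nil.
rewrite big_cons expnMn /= expnS leq_mul ?h ?mem_head //.
by apply: IH => q qs; apply: h; rewrite inE qs orbT.
Qed.

(** * Construction of the two windows *)

Lemma nprimes_le k : nprimes k <= k.
Proof. by rewrite /nprimes /= add0n (leq_trans (count_size _ _)) // size_iota. Qed.

(** The set [s] has four primes, enough for a product of order [k ^ 2]; [t]
    has so many that [B] steps of relative length at least [1 / k] along each of
    them cover twice the whole period. *)
Lemma many_gap_primes N : exists k0, forall k, k0 <= k -> exists B s t,
  [/\ uniq (s ++ t), {subset s ++ t <= gap_primes k (2 * (N * B))},
      size s = 4, 2 <= size t & 2 * k <= size t * B].
Proof.
(* Out of (4 * N + 6) * B primes, B are discarded as too small and 4 * N * B for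
   lack of a gap; s takes 4 <= 4 * B, and B are left for t. *)
have [k0 h] := many_primes (4 * N + 6).
exists (k0 + 2) => k hk.
have [|B [B0 kB cB]] := h k; first lia.
have J : 2 * (N * B) <= k by have := nprimes_le k; nia.
have k1 : 0 < k by lia.
have B2 : 2 <= B by rewrite -leq_sqr; lia.
have := nprimes_gap k1 J kB; set g := gap_primes _ _ => hg.
have gB : B + 4 <= size g by nia.
exists B, (take 4 g), (drop 4 g); rewrite cat_take_drop; split=> //.
- by rewrite filter_uniq // iota_uniq.
- by rewrite size_take_min; apply/minn_idPl; apply: leq_trans gB; rewrite leq_addl.
- by rewrite size_drop; move: (size g) gB; lia.
- by rewrite size_drop (leq_trans kB) // expnS expn1 leq_mul2r; move: (size g) gB; lia.
Qed.

Lemma gap_primesP k J p : p \in gap_primes k J ->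
  [/\ prime p, p <= k, 2 * k < p ^ 2, J <= k %% p & k %% p + J < p].
Proof. by rewrite mem_filter mem_iota add0n ltnS => /andP[/and4P[]]. Qed.

Lemma coprime_prod_seq (s : seq nat) m : {in s, forall p, coprime m p} ->
  coprime m (\prod_(p <- s) p).
Proof.
elim: s => [|p s IH] h; first by rewrite big_nil coprimen1.
rewrite big_cons coprimeMr h ?mem_head //=; apply: IH => q qs.
by apply: h; rewrite inE qs orbT.
Qed.

Lemma prod_primes_dvd (s : seq nat) m : uniq s -> {in s, forall p, prime p} ->
  {in s, forall p, p %| m} -> \prod_(p <- s) p %| m.
Proof.
elim: s => [|p s IH] /=; first by rewrite big_nil dvd1n.
case/andP=> ps us hp hd; rewrite big_cons Gauss_dvd.
  rewrite hd ?mem_head //= IH // => q qs; [apply: hp|apply: hd]; by rewrite inE qs orbT.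
have pp : prime p by apply/hp/mem_head.
apply: coprime_prod_seq => q qs.
rewrite prime_coprime // dvdn_prime2 //; last by apply: hp; rewrite inE qs orbT.
by apply/eqP => e; rewrite e qs in ps.
Qed.

(** A prime up to k whose square exceeds k divides the lcm exactly once. *)
Lemma lcm_factor k (s : seq nat) : uniq s ->
  {in s, forall p, [/\ prime p, p <= k & k < p ^ 2]} ->
  exists M, [/\ lcm_itv 1 k.+1 = M * \prod_(p <- s) p, {in s, forall p, coprime M p} &
    forall q j, prime q -> 0 < j -> q \notin s -> q ^ j <= k -> q ^ j %| M].
Proof.
move=> us hs; have L0 : 0 < lcm_itv 1 k.+1 by rewrite lcm_itv_gt0.
have hp : {in s, forall p, prime p} by move=> p /hs[].
have PL : \prod_(p <- s) p %| lcm_itv 1 k.+1.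
  apply: prod_primes_dvd => // p /hs[pp pk _].
  rewrite -[p]expn1; apply/pfactor_dvd_lcm_itv => //.
  by exists p; rewrite ?expn1 // prime_gt0.
exists (lcm_itv 1 k.+1 %/ \prod_(p <- s) p); split; first by rewrite divnK.
  move=> p ps; have [pp pk kp] := hs p ps.
  rewrite coprime_sym prime_coprime //; apply/negP => pd.
  have : p ^ 2 %| lcm_itv 1 k.+1.
    by rewrite -(divnK PL) expnS expn1 dvdn_mul // (big_rem p) //= dvdn_mulr.
  case/pfactor_dvd_lcm_itv => // n hn /dvdn_leq h; lia.
move=> q j pq j0 qs qk.
have : q ^ j %| lcm_itv 1 k.+1.
  by apply/pfactor_dvd_lcm_itv => //; exists (q ^ j); rewrite // expn_gt0 prime_gt0.
rewrite -{1}(divnK PL) Gauss_dvdl // coprimeXl //; apply: coprime_prod_seq => p ps.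
rewrite prime_coprime // dvdn_prime2 //; last exact: hp.
by apply/eqP => e; rewrite e ps in qs.
Qed.

Lemma seq_choice (s : seq nat) (P : nat -> nat -> Prop) :
  {in s, forall p, exists e, P p e} -> exists f, {in s, forall p, P p (f p)}.
Proof.
elim: s => [|p s IH] h; first by exists id.
have [e he] := h p (mem_head _ _).
have [|f hf] := IH; first by move=> q qs; apply: h; rewrite inE qs orbT.
exists (fun q => if q == p then e else f q) => q; rewrite inE.
by case: eqP => [->|_] //= qs; apply: hf.
Qed.

(** The offset of [x] splits the residue of [D] into a part spent after the
    left window and a part spent inside the right one. *)
Lemma gain_at_shift k x D q i : 0 < q -> i + k %% q < q -> i <= D %% q <= i + k %% q ->
  q %| x + k + i -> gain_at k x (x + D) q.
Proof.
move=> q0 h1 h2 h3; exists i, (D %% q - i).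
have Dm := leq_mod D q.
split=> //; [lia|lia|].
have -> : x + D + k - (D %% q - i) = x + k + i + (D - D %% q) by lia.
by rewrite dvdn_add // {1}(divn_eq D q) addnK dvdn_mull.
Qed.

Lemma dvdn_opp_mod x m a : 0 < m -> x = a * m.-1 %[mod m] -> m %| x + a.
Proof.
case: m => // m _ /= e; rewrite /dvdn -modnDml e modnDml -mulnSr.
by rewrite modnMl.
Qed.

(** With [L = lcm_itv 1 k.+1 = M * Ps * Pt], where [Ps] and [Pt] are the products
    of [s] and [t], the shift [D] is chosen first: 0 mod [M], [2 * (N * B)] mod the
    primes of [t], and free mod the primes of [s], which is what makes it smaller
    than [L / k ^ 2] up to a constant. For such [D] a gain at [q] requires
    [x = -k] mod [q] for the prime powers in [M], has at least one solution mod each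
    prime of [s], and has [2 * (N * B) + 1] consecutive solutions mod each prime of
    [t]. A starting solution given by the Chinese remainder theorem is then lowered
    to the order of [L / N], using this freedom at the primes of [t]. *)
Lemma gain_everywhere k N B (s t : seq nat) : 4 <= N -> N ^ 2 <= k ->
  uniq (s ++ t) -> {subset s ++ t <= gap_primes k (2 * (N * B))} ->
  size s = 4 -> 2 <= size t -> 2 * k <= size t * B ->
  exists x D, [/\ forall p j, prime p -> 0 < j -> p ^ j <= k -> gain_at k x (x + D) (p ^ j),
    k < D, 2 * k * D <= x, 2 * lcm_itv 1 k.+1 <= N * x & N * x <= 5 * lcm_itv 1 k.+1].
Proof.
move=> N4 Nk ust gst ss st kB.
have Nk' : 4 * N <= k by nia.
set L := lcm_itv 1 k.+1.
have L0 : 0 < L by rewrite lcm_itv_gt0.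
have k0 : 0 < k by lia.
have kL : k <= L.
  by apply: dvdn_leq L0 _; rewrite /L /lcm_itv big_nat_recr //= dvdn_lcmr.
have gP p : p \in s ++ t -> [/\ prime p, p <= k, 2 * k < p ^ 2, 2 * (N * B) <= k %% p & k %% p + 2 * (N * B) < p].
  by move/gst/gap_primesP.
have [|M [LM coM dM]] := @lcm_factor k (s ++ t) ust.
  by move=> p /gP[h1 h2 h3 _ _]; split=> //; lia.
rewrite -/L big_cat /= in LM.
set Ps := \prod_(p <- s) p in LM; set Pt := \prod_(p <- t) p in LM.
have tst p : p \in t -> p \in s ++ t by rewrite mem_cat => ->; rewrite orbT.
have sst p : p \in s -> p \in s ++ t by rewrite mem_cat => ->.
move: (ust); rewrite cat_uniq => /and3P[us dst ut].
have [M0 Ps0 Pt0] : [/\ 0 < M, 0 < Ps & 0 < Pt].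
  by move: L0; rewrite LM !muln_gt0 => /and3P[].
have Psk : 4 * k ^ 2 <= Ps.
  have := @prod_sqr_ge s (2 * k) _; rewrite ss -/Ps.
  move=> h; have : (2 * k) ^ 4 <= Ps ^ 2 by apply: h => p /sst/gP[]; lia.
  by rewrite (expnM _ 2 2) leq_sqr expnMn.
have Ptk : 2 * k <= Pt.
  have h : (2 * k) ^ size t <= Pt ^ 2 by apply: prod_sqr_ge => p /tst/gP[]; lia.
  rewrite -leq_sqr; apply: leq_trans h; rewrite leq_pexp2l //; lia.
(* The shift. Adding M * Pt keeps its residues and makes D larger than k. *)
have [p /tst/gP[]//|p /tst/coM//|D1 [D1M D1t]] := @chinese_seq t M 0 (fun=> 2 * (N * B)) ut M0.
pose D := D1 %% (M * Pt) + M * Pt.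
have MPt0 : 0 < M * Pt by rewrite muln_gt0 M0.
have DD : M * Pt <= D < 2 * (M * Pt) by rewrite /D; have := ltn_pmod D1 MPt0; lia.
have Dm d : d %| M * Pt -> D %% d = D1 %% d.
  move=> hd; rewrite /D -modnDmr (eqP hd) addn0; exact: modn_dvdm.
have DM : M %| D by rewrite /dvdn Dm ?dvdn_mulr // D1M mod0n.
have Dt p : p \in t -> D %% p = 2 * (N * B).
  move=> pt; have [_ _ _ _ h] := gP p (tst p pt).
  rewrite Dm ?D1t ?modn_small //; first exact: leq_ltn_trans (leq_addl _ _) h.
  by rewrite /Pt (big_rem p) //= dvdn_mull // dvdn_mulr.
have [DD1 DD2] := andP DD.
have PtD : Pt <= D by apply: leq_trans DD1; rewrite leq_pmull.
have kD : k < D by clear -k0 Ptk PtD; lia.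
have LD : 2 * k ^ 2 * D <= L.
  rewrite LM mulnCA; apply: (@leq_trans (2 * k ^ 2 * (2 * (M * Pt)))).
    by rewrite leq_mul2l ltnW ?orbT.
  by rewrite mulnA leq_mul2r mulnAC Psk orbT.
(* The offset of p is N * B at the primes of t, the middle of the allowed range
   [0, 2 * (N * B)], so that both directions are open. At the primes of s the
   residue of D is arbitrary, and this offset satisfies gain_at_shift. *)
pose idx p := if p \in t then N * B else minn (D %% p) (p.-1 - k %% p).
have [p /gP[]//|p /coM//|x1 [x1M x1t]] :=
  @chinese_seq (s ++ t) M (k * M.-1) (fun p => (k + idx p) * p.-1) ust M0.
pose x0 := x1 %% L + L.
have x0L : L <= x0 < 2 * L by rewrite /x0 leq_addl mul2n -addnn ltn_add2r ltn_pmod.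
have x0m d : d %| L -> x0 = x1 %[mod d].
  move=> hd; rewrite /x0 -modnDmr (eqP hd) addn0; exact: modn_dvdm.
have x0M : M %| x0 + k.
  by apply: dvdn_opp_mod => //; rewrite x0m ?x1M // LM dvdn_mulr.
have pL p : p \in s ++ t -> p %| L.
  by move=> ps; rewrite LM dvdn_mull // -big_cat (big_rem p) //= dvdn_mulr.
have x0t p : p \in s ++ t -> p %| x0 + k + idx p.
  move=> ps; have [pp _ _ _ _] := gP p ps.
  by rewrite -addnA; apply: dvdn_opp_mod; rewrite ?prime_gt0 // x0m ?x1t // pL.
(* Admissible steps: eps p is a multiple of L / p, so it leaves every other
   residue alone, and it changes the residue mod p by less than N, with a sign
   that is not controlled. *)
pose step p e := [/\ L <= k * e, N * e <= 2 * L, L %/ p %| e &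
   exists2 g, g < N & (p %| e + g) || ((g <= e) && (p %| e - g))].
have [eps heps] : exists eps, {in t, forall p, step p (eps p)}.
  apply: (@seq_choice t step) => p pt.
  have [pp pk p2 _ _] := gP p (tst p pt).
  have Np : N <= p.
    rewrite -leq_sqr ltnW // (leq_ltn_trans _ p2) // (leq_trans Nk) //.
    by rewrite leq_pmull.
  have [|a [g [a0 aN gN hg]]] := @small_multiple p (L %/ p) N.
    by rewrite (leq_trans _ N4) //= Np.
  have eL := divnK (pL p (tst p pt)).
  exists (L %/ p * a); split; [| |by rewrite dvdn_mulr|by exists g].
    by rewrite -{1}eL mulnCA leq_mul2l (leq_trans pk) ?orbT // leq_pmulr.
  have -> : 2 * L = L %/ p * (p + p) by rewrite mulnDr eL mul2n addnn.
  by rewrite mulnC -mulnA leq_mul2l (leq_trans aN) ?orbT // leq_add2l.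
have dvL p q : p \in t -> q \in s ++ t -> q != p -> q %| eps p.
  move=> pt qs qp; have [_ _ h _] := heps p pt; apply: dvdn_trans h.
  have [pp _ _ _ _] := gP p (tst p pt); have [pq _ _ _ _] := gP q qs.
  have := pL q qs; rewrite -{1}(divnK (pL p (tst p pt))) Gauss_dvdl //.
  by rewrite prime_coprime // dvdn_prime2.
have dvM p : p \in t -> M %| eps p.
  move=> pt; have [_ _ h _] := heps p pt; apply: dvdn_trans h.
  have : M %| L by rewrite LM dvdn_mulr.
  by rewrite -{1}(divnK (pL p (tst p pt))) Gauss_dvdl //; apply/coM/tst.
(* The target interval [W + 1, 2 * W + 1] starts just above 2 * L / N. *)
pose W := 2 * L %/ N.
have N0 : 0 < N by apply: leq_trans N4.
have WN := divn_eq (2 * L) N; have WN' : (2 * L) %% N < N by rewrite ltn_mod.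
rewrite -/W in WN.
have W4 : 4 * W <= 2 * L by apply: leq_trans (leq_trunc_div (2 * L) N); rewrite mulnC leq_mul2l N4 orbT.
have [|||n [nB hn]] := @descend_sum t eps W.+1 W x0 B ut.
- by clear -W4 x0L kL Nk' N4; lia.
- by move=> p /heps[_ h _ _]; rewrite leq_divRL // mulnC.
- have h : size t * L <= k * \sum_(p <- t) eps p.
    rewrite -sum1_size big_distrl big_distrr /= big_seq [leqRHS]big_seq.
    by apply: leq_sum => p /heps[h _ _ _]; rewrite mul1n.
  rewrite -big_distrr /=.
  have : 2 * L <= B * \sum_(p <- t) eps p; last by clear -x0L; lia.
  rewrite -(leq_pmul2l k0) mulnA (mulnC k) (leq_trans (n := size t * B * L)) //.
    by rewrite leq_mul2r kB orbT.
  by rewrite mulnAC [leqRHS]mulnCA [leqRHS]mulnC leq_mul2r h orbT.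
set S := \sum_(p <- t) n p * eps p in hn.
pose x := x0 - S.
have xS : x + S = x0 by rewrite /x subnK // (leq_trans _ (andP hn).1) // leq_addl.
have xW : W.+1 <= x <= W.+1 + W by move: hn; rewrite -xS; clear; lia.
have NxL : 2 * L <= N * x.
  rewrite WN; apply: (@leq_trans (N * W.+1)); first by rewrite mulnS mulnC addnC leq_add2r ltnW.
  by rewrite leq_mul2l; case/andP: xW => ->; rewrite orbT.
have NxL' : N * x <= 5 * L.
  apply: (@leq_trans (N * (W.+1 + W))); first by rewrite leq_mul2l; case/andP: xW => _ ->; rewrite orbT.
  have : N * W <= 2 * L by rewrite mulnC; exact: leq_trunc_div.
  by rewrite mulnDr mulnS; clear -kL Nk' N4; move: (N * W); lia.
have kDx : 2 * k * D <= x.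
  rewrite -(leq_pmul2l N0); apply: leq_trans NxL; apply: leq_trans (leq_pmull _ _) => //.
  apply: leq_trans LD; rewrite mulnA leq_mul2r; apply/orP; right.
  by rewrite mulnCA expnS expn1 leq_mul2l /= leq_mul2r; apply/orP; right; clear -Nk'; lia.
have SM : M %| S.
  by rewrite /S big_seq; apply: dvdn_sum => p pt; rewrite dvdn_mull // dvM.
have xM : M %| x + k.
  by move: x0M; rewrite -xS addnAC dvdn_addl.
exists x, D; split=> // p j pp j0 pjk; have p1 := prime_gt1 pp.
have [pst|pst] := boolP (p \in s ++ t); last first.
  have dj := dM p j pp j0 pst pjk.
  have q0 : 0 < p ^ j by rewrite expn_gt0 ltnW.
  apply: (@gain_at_shift _ _ _ _ 0); rewrite ?ltn_mod //.
    by rewrite (eqP (dvdn_trans dj DM)).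
  by rewrite addn0 (dvdn_trans dj).
have [_ pk p2 r1 r2] := gP p pst.
have j1 : j = 1.
  case: j j0 pjk => [|[|j]] // _ h.
  have pj : p ^ 2 <= p ^ j.+2 by rewrite leq_exp2l.
  by move: p2; rewrite ltnNge (leq_trans (leq_trans pj h)) // leq_pmull.
rewrite {j j0 pjk}j1 expn1.
have [pt|pt] := boolP (p \in t).
  have x0p := x0t p pst; rewrite /idx pt in x0p.
  have [_ _ _ [g gN hg]] := heps p pt.
  have nBp := nB p.
  have ng : n p * g <= N * B by rewrite mulnC leq_mul // ltnW.
  have pS : p %| S - n p * eps p.
    rewrite /S (big_rem p) //= addKn big_seq; apply: dvdn_sum => q.
    rewrite mem_rem_uniq // inE => /andP[qp qt].
    by rewrite dvdn_mull // dvL // eq_sym.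
  have leS : n p * eps p <= S by rewrite /S (big_rem p) //= leq_addr.
  have px : p %| x + k + N * B + n p * eps p.
    have e : x0 + k + N * B = x + k + N * B + n p * eps p + (S - n p * eps p).
      by rewrite -xS; clear -leS; lia.
    by move: x0p; rewrite e dvdn_addl.
  case/orP: hg => [hg|/andP[gle hg]].
    apply: (@gain_at_shift _ _ _ _ (N * B - n p * g)); rewrite ?Dt //.
    - by rewrite ltnW.
    - by clear -r2 ng; lia.
    - by clear -r1 ng; lia.
    have h : p %| n p * (eps p + g) by rewrite dvdn_mull.
    rewrite -(dvdn_addl _ h) (_ : _ + _ = x + k + N * B + n p * eps p) //.
    by rewrite mulnDr; clear -ng; lia.
  apply: (@gain_at_shift _ _ _ _ (N * B + n p * g)); rewrite ?Dt //.
  - by rewrite ltnW.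
  - by clear -r2 ng; lia.
  - by clear -r1 ng; lia.
  have h : p %| n p * (eps p - g) by rewrite dvdn_mull.
  have h2 : n p * g <= n p * eps p by rewrite leq_mul2l gle orbT.
  rewrite -(dvdn_addl _ h) mulnBr (_ : _ + _ = x + k + N * B + n p * eps p) //.
  by clear -h2; lia.
have ep := x0t p pst; rewrite /idx (negbTE pt) in ep.
have pS : p %| S.
  rewrite /S big_seq; apply: dvdn_sum => q qt.
  by rewrite dvdn_mull // dvL //; apply: contraNneq pt => ->.
have rp : k %% p < p by rewrite ltn_mod ltnW.
have rD : D %% p < p by rewrite ltn_mod ltnW.
apply: (@gain_at_shift _ _ _ _ (minn (D %% p) (p.-1 - k %% p))).
- by rewrite ltnW.
- by move: (D %% p) (k %% p) rp => a b; clear -p1; lia.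
- by move: (D %% p) (k %% p) rp rD => a b; clear; lia.
move: ep; rewrite -xS (_ : x + S + k + _ = x + k + minn (D %% p) (p.-1 - k %% p) + S); last by clear; lia.
by rewrite dvdn_addl.
Qed.

(** By [gain_everywhere] the quotient of the lcms is at least [L] times the
    quotient of the products, which is at least [1 / (8 * x)] as [x] is much larger
    than [k * D]. As [x] is at most [5 * L / N], the factor [N = 40 * C.+1] suffices. *)
Lemma lcm_windows_nat C : exists k0, forall k, k0 <= k -> exists x y,
  [/\ 0 < x < y, x + k < y & C * lcm_itv y (y + k).+1 < lcm_itv x (x + k)].
Proof.
pose N := 40 * C.+1.
have [k1 sel] := many_gap_primes N.
exists (k1 + N ^ 2) => k hk.
have [|B [s [t [h1 h2 h3 h4 h5]]]] := sel k; first lia.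
have [|| x [D [G kD kDx Lx xL]]] := @gain_everywhere k N B s t _ _ h1 h2 h3 h4 h5; [lia|lia|].
set L := lcm_itv 1 k.+1 in Lx xL.
have L0 : 0 < L by rewrite lcm_itv_gt0.
have k0 : 0 < k by nia.
have Dx : D <= x by nia.
have x0 : 0 < x by lia.
exists x, (x + D); split; [lia|lia|].
have y0 : 0 < x + D by lia.
have := lcm_mul_dvd_of_gain x0 y0 G; rewrite -addnS.
have [ly lx] : 0 < lcm_itv (x + D) (x + D + k.+1) /\ 0 < lcm_itv x (x + k) by rewrite !lcm_itv_gt0.
have px : 0 < \prod_(l < k) (x + l) by apply/prodn_gt0 => l; lia.
have kDy : k * D <= x + D by lia.
have := prod_shift_le kDy; rewrite addnK big_ord_recr /=.
have py : 0 < \prod_(l < k) (x + D + l) by apply/prodn_gt0 => l; lia.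
move: (\prod_(l < k) (x + l)) (\prod_(l < k) (x + D + l)) px py => X Y X0 Y0.
rewrite -/L; move: (lcm_itv (x + D) _) (lcm_itv x _) ly lx => ly lx ly0 lx0 hXY.
have YX : Y <= 2 * X.
  have : (x + D) * Y <= (x + D) * (2 * X); last by rewrite leq_pmul2l.
  have : (x + D) * Y <= 2 * (x + D - k * D) * Y by rewrite leq_mul2r; lia.
  lia.
move/dvdn_leq; rewrite !muln_gt0 lx0 Y0 /= (_ : 0 < x + D + k); last lia.
move=> /(_ isT) h.
have h6 : ly * L * X <= lx * (8 * x) * X.
  apply: (leq_trans h); rewrite -!mulnA leq_mul2l; apply/orP; right.
  have : x + D + k <= 4 * x by lia.
  nia.
move: h6; rewrite leq_pmul2r // => h6.
have h7 : (N * ly) * L <= (40 * lx) * L by nia.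
move: h7; rewrite leq_pmul2r // /N; nia.
Qed.

Import Order.TTheory GRing.Theory Num.Theory.
Local Open Scope ring_scope.

Theorem theorem1 (R : realType) (C : R) (hC : 1 <= C) :
  exists k0 : nat, forall k : nat, (k0 <= k)%N ->
    exists x y : nat,
      [/\ (0 < x < y)%N,
          (x + k < y)%N
        & C * (\big[lcmn/1%N]_(y <= n < (y + k).+1) n)%:R
            < (\big[lcmn/1%N]_(x <= n < x + k) n)%:R].
Proof.
have [k0 hk0] := lcm_windows_nat (Num.truncn C).+1.
exists k0 => k /hk0[x [y [xy xky lt_lcm]]]; exists x, y; split=> //.
apply: (@le_lt_trans _ _ ((Num.truncn C).+1%:R * (lcm_itv y (y + k).+1)%:R)).
  by rewrite ler_wpM2r // ltW // truncnS_gt.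
by rewrite -natrM ltr_nat.
Qed.
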